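(* Let $\mathcal{M}=(\mathcal{E},\mathcal{I})$ be a matroid on a finite ground set $\mathcal{E}$, let $\mathcal{D}$ be a distribution supported on $2^{\mathcal{E}}$, and let $\alpha\ge 1$. The following are equivalent: (a) $\mathcal{D}$ is $\alpha$-uncontentious, i.e. it admits an $\alpha$-competitive contention resolution map. (b) For every weight vector $w\in\mathbb{R}_+^{\mathcal{E}}$, with $R\sim\mathcal{D}$, $\mathbb{E}[\mathrm{rank}_w(R)]\ge \frac{1}{\alpha}\mathbb{E}[w(R)]$. (c) For every $\mathcal{F}\subseteq\mathcal{E}$, with $R\sim\mathcal{D}$, $\mathbb{E}[|R\cap\mathcal{F}|]\le \alpha\,\mathbb{E}[\mathrm{rank}(R\cap\mathcal{F})]$.
   Context: A contention resolution map (CRM) for $\mathcal{M}$ is a randomized function $\phi:2^{\mathcal{E}}\to\mathcal{I}$ with $\phi(R)\subseteq R$ for all $R\subseteq\mathcal{E}$. It is $\alpha$-competitive for $\mathcal{D}$ if, for $R\sim\mathcal{D}$, $\Pr[i\in R]\le\alpha\Pr[i\in\phi(R)]$ for all $i\in\mathcal{E}$. $\mathrm{rank}(A)$ is the matroid rank of $A$; for $w\in\mathbb{R}_+^{\mathcal{E}}$, $\mathrm{rank}_w(A)$ is the maximum of $w(I)=\sum_{i\in I}w_i$ over independent sets $I\subseteq A$, and $w(A)=\sum_{i\in A}w_i$. *)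

(* Defs.v *)
From HB Require Import structures.
From mathcomp Require Import all_boot all_order all_algebra.
From mathcomp Require Import reals.
Set Implicit Arguments.
Unset Strict Implicit.
Unset Printing Implicit Defensive.

Import Order.TTheory GRing.Theory Num.Theory.
Local Open Scope ring_scope.

Record matroid (E : finType) := Matroid {
  indep :> pred {set E};
  indep0 : indep set0;
  indep_sub : forall A B : {set E}, A \subset B -> indep B -> indep A;
  indep_exchange : forall A B : {set E}, indep A -> indep B ->
    (#|A| < #|B|)%N -> exists2 x, x \in B :\: A & indep (x |: A)
}.

Definition rank (E : finType) (M : matroid E) (A : {set E}) : nat :=
  \max_(I : {set E} | indep M I && (I \subset A)) #|I|.

Definition weight (R : realType) (E : finType) (w : E -> R) (A : {set E}) : R :=
  \sum_(i in A) w i.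

(* The default value 0 is the weight of the independent set [set0], so this is
   a genuine maximum over the independent subsets of [A]. *)
Definition wrank (R : realType) (E : finType) (M : matroid E) (w : E -> R)
    (A : {set E}) : R :=
  \big[Num.max/0]_(I : {set E} | indep M I && (I \subset A)) weight w I.

Record dist (R : realType) (T : finType) := Dist {
  pmf :> T -> R;
  pmf_ge0 : forall x, 0 <= pmf x;
  pmf_sum1 : \sum_x pmf x = 1
}.

Definition Pr (R : realType) (T : finType) (D : dist R T) (A : {set T}) : R :=
  \sum_(x in A) D x.

Definition Ex (R : realType) (T : finType) (D : dist R T) (f : T -> R) : R :=
  \sum_x D x * f x.

Section Bind.
Variables (R : realType) (T U : finType) (D : dist R T) (k : T -> dist R U).

Definition bind_pmf (y : U) : R := \sum_x D x * k x y.

Lemma bind_pmf_ge0 y : 0 <= bind_pmf y.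
Proof. by apply: sumr_ge0 => x _; rewrite mulr_ge0 ?pmf_ge0. Qed.

Lemma bind_pmf_sum1 : \sum_y bind_pmf y = 1.
Proof.
rewrite exchange_big /= -(pmf_sum1 D); apply: eq_bigr => x _.
by rewrite -mulr_sumr pmf_sum1 mulr1.
Qed.

(* The law of [k X] when [X] has law [D] and the internal randomness of [k] is
   independent of [X]. *)
Definition bind : dist R U := Dist bind_pmf_ge0 bind_pmf_sum1.
End Bind.

(* A randomized function is represented by a Markov kernel: [phi S] is the law
   of its value at [S]. *)
Definition contention_resolution_map (R : realType) (E : finType)
    (M : matroid E) (phi : {set E} -> dist R {set E}) : Prop :=
  forall S I : {set E}, phi S I != 0 -> indep M I /\ I \subset S.

Definition competitive (R : realType) (E : finType) (alpha : R)
    (D : dist R {set E}) (phi : {set E} -> dist R {set E}) : Prop :=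
  forall i : E,
    Pr D [set S : {set E} | i \in S] <= alpha * Pr (bind D phi) [set I : {set E} | i \in I].

Definition uncontentious (R : realType) (E : finType) (M : matroid E)
    (alpha : R) (D : dist R {set E}) : Prop :=
  exists phi : {set E} -> dist R {set E},
    contention_resolution_map M phi /\ competitive alpha D phi.

(* Main.v *)
(** (a) => (b) holds because [wrank M w S] dominates the expected weight of
    [phi S], and (b) => (c) is the case where [w] is an indicator function.
    For (c) => (b), peel the layers of [w]: if [t] is the least positive value
    of [w] and [F] its support, then the weighted rank for [w] is at least that
    for [w - t 1_F] plus [t] times the rank of the trace on [F], because an
    independent subset of [S :&: F] extends to a basis of [S :&: F].
    Finally (b) => (a) is linear programming duality: (b) says that the linear
    system defining an [alpha]-competitive map has no Farkas certificate of
    infeasibility. *)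

Require Import Defs.
From HB Require Import structures.
From mathcomp Require Import all_boot all_order all_algebra.
From mathcomp Require Import reals.
From mathcomp Require Import ring.
Set Implicit Arguments.
Unset Strict Implicit.
Unset Printing Implicit Defensive.

Import Order.TTheory GRing.Theory Num.Theory.
Local Open Scope ring_scope.

(** * Farkas' lemma over an ordered field *)

Definition dot (R : pzRingType) (T : finType) (a x : T -> R) : R :=
  \sum_t a t * x t.

Lemma dotBZl (R : comPzRingType) (T : finType) (a b x : T -> R) (k : R) :
  dot (fun t => a t - k * b t) x = dot a x - k * dot b x.
Proof.
rewrite /dot mulr_sumr -sumrB; apply: eq_bigr => t _.
by rewrite mulrBl mulrA.
Qed.

Lemma dotBZr (R : comPzRingType) (T : finType) (a x y : T -> R) (k : R) :
  dot a (fun t => x t - k * y t) = dot a x - k * dot a y.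
Proof.
rewrite /dot mulr_sumr -sumrB; apply: eq_bigr => t _.
by rewrite mulrBr mulrCA.
Qed.

(* Bartl's induction on the number of generators: a certificate [x0] that fails
   only at the new generator [a j] is used to project along [x0] onto the
   hyperplane orthogonal to [a j], where the other generators are handled by
   induction. *)
Lemma farkas_seq (R : realFieldType) (T : finType) (J : eqType) (s : seq J)
    (a : J -> T -> R) (c : T -> R) :
  uniq s ->
  (exists2 l : J -> R, forall j, 0 <= l j &
     forall t, c t = \sum_(j <- s) l j * a j t) \/
  (exists2 x : T -> R, forall j, j \in s -> dot (a j) x <= 0 & 0 < dot c x).
Proof.
elim: s a c => [|j s IHs] a c /=.
  move=> _; case: (boolP [forall t, c t == 0]) => [/forallP c0|].
    by left; exists (fun=> 0) => // t; rewrite big_nil; apply/eqP.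
  (* With no generators, a nonzero [c] separates itself: [dot c c] is a positive sum of squares. *)
  rewrite negb_forall => /existsP[t0 ct0]; right; exists c => //.
  rewrite /dot (bigD1 t0) //= ltr_wpDr //.
    by apply: sumr_ge0 => t _; rewrite -expr2 sqr_ge0.
  by rewrite -expr2 exprn_even_gt0.
case/andP=> js us; case: (IHs a c us) => [[l l0 cE]|[x0 ax0 cx0]].
  left; exists (fun i => if i == j then 0 else l i) => [i|t]; first by case: ifP.
  rewrite big_cons eqxx mul0r add0r cE; apply: eq_big_seq => i si.
  by case: eqP si js => // -> ->.
have [ajx0|ajx0] := leP (dot (a j) x0) 0.
  by right; exists x0 => // i; rewrite inE => /orP[/eqP->|/ax0].
pose k := dot (a j) x0; have k0 : k != 0 by rewrite gt_eqF.
pose pr (b : T -> R) t := b t - dot b x0 / k * a j t.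
(* [pr] makes functionals vanish at [x0]. It is adjoint to the projection of points along [x0], so a
   separating point for the projected data projects to one for the original data. *)
have prE b x : dot (pr b) x = dot b (fun t => x t - dot (a j) x / k * x0 t).
  by rewrite dotBZl dotBZr; ring.
case: (IHs (fun i => pr (a i)) (pr c) us) => [[l l0 cE]|[x ax cx]].
(* [m] is the coefficient of [a j] left after unfolding [pr]; it is nonnegative since [dot c x0] is
   positive and [dot (a i) x0 <= 0] on [s]. *)
- left; pose m := (dot c x0 - \sum_(i <- s) l i * dot (a i) x0) / k.
  exists (fun i => if i == j then m else l i) => [i|t].
    case: ifP => // _; apply: divr_ge0; last exact: ltW.
    rewrite subr_ge0 (le_trans _ (ltW cx0)) // big_seq sumr_le0 // => i' si'.
    by rewrite mulr_ge0_le0 ?ax0.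
  rewrite big_cons eqxx.
  have -> : \sum_(i <- s) (if i == j then m else l i) * a i t =
            \sum_(i <- s) l i * a i t.
    by apply: eq_big_seq => i si; case: eqP si js => // -> ->.
  have := cE t; rewrite /pr.
  under eq_bigr => i _ do rewrite mulrBr !mulrA.
  rewrite sumrB -!mulr_suml => /eqP; rewrite subr_eq => /eqP ->.
  by rewrite /m; ring.
- right; exists (fun t => x t - dot (a j) x / k * x0 t); last by rewrite -prE.
  move=> i; rewrite inE => /orP[/eqP->|/ax]; last by rewrite -prE.
  by rewrite dotBZr -/k divfK ?subrr.
Qed.

Lemma farkas (R : realFieldType) (T J : finType) (a : J -> T -> R) (c : T -> R) :
  (forall x, (forall j, dot (a j) x <= 0) -> dot c x <= 0) ->
  exists2 l : J -> R, forall j, 0 <= l j & forall t, c t = \sum_j l j * a j t.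
Proof.
move=> ac; case: (farkas_seq a c (index_enum_uniq J)) => // -[x ax].
by rewrite ltNge ac // => j; apply: ax; rewrite mem_index_enum.
Qed.

(** * Bases of a set in a matroid *)

Lemma leq_rank (E : finType) (M : matroid E) (A I : {set E}) :
  indep M I -> I \subset A -> (#|I| <= rank M A)%N.
Proof.
by move=> iI IA; apply: (@leq_bigmax_cond _ _ (fun I : {set E} => #|I|) I);
   rewrite iI IA.
Qed.

(** If a largest independent set between [I] and [A] fell short of the rank, exchange with an
    independent subset of [A] of rank size would enlarge it. *)
Lemma indep_extend (E : finType) (M : matroid E) (A I : {set E}) :
  indep M I -> I \subset A ->
  exists J : {set E}, [/\ indep M J, I \subset J, J \subset A & #|J| = rank M A].
Proof.
move=> iI IA; pose P (J : {set E}) := [&& indep M J, I \subset J & J \subset A].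
have PI : P I by rewrite /P iI IA subxx.
case: (arg_maxnP (fun J : {set E} => #|J|) PI) => J /and3P[iJ IJ JA] Jmax.
exists J; split=> //; apply/eqP; rewrite eqn_leq leq_rank //= leqNgt.
apply/negP => ltJ.
have [|B /andP[iB BA] rB] := @eq_bigmax_cond _
    [pred B : {set E} | indep M B && (B \subset A)] (fun B : {set E} => #|B|).
  by apply/card_gt0P; exists I; rewrite inE iI IA.
rewrite [rank M A]rB in ltJ; have [x /setDP[xB xJ] ixJ] := indep_exchange iJ iB ltJ.
have /Jmax : P (x |: J).
  rewrite /P ixJ subUset sub1set (subsetP BA) //= JA.
  by rewrite (subset_trans IJ) // subsetUr.
by rewrite /= cardsU1 xJ ltnn.
Qed.

(** * Weighted rank and its expectation *)

Section WeightedRank.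
Variables (R : realType) (E : finType) (M : matroid E).
Implicit Types (w : E -> R) (S I F : {set E}) (D : dist R {set E}).

Lemma le_wrank w S I : indep M I -> I \subset S -> weight w I <= wrank M w S.
Proof. by move=> iI IS; apply: le_bigmax_cond; rewrite iI IS. Qed.

Lemma wrank_le w S (m : R) :
  (forall I, indep M I -> I \subset S -> weight w I <= m) -> wrank M w S <= m.
Proof.
move=> wm; apply: bigmax_le => [|I /andP[]]; last exact: wm.
by have := wm set0 (indep0 M) (sub0set S); rewrite /weight big_set0.
Qed.

Lemma wrank_ge0 w S : 0 <= wrank M w S.
Proof. exact: bigmax_ge_id. Qed.

Lemma weight_indicator F S : weight (fun i => (i \in F)%:R) S = #|S :&: F|%:R :> R.
Proof.
rewrite /weight -sum1_card natr_sum [LHS]big_mkcond [RHS]big_mkcond /=.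
by apply: eq_bigr => i _; rewrite inE; case: (i \in S); case: (i \in F).
Qed.

Lemma wrank_indicator_le F S :
  wrank M (fun i => (i \in F)%:R) S <= (rank M (S :&: F))%:R :> R.
Proof.
apply: wrank_le => I iI IS; rewrite weight_indicator ler_nat leq_rank ?setSI //.
exact: indep_sub (subsetIl _ _) iI.
Qed.

Lemma weight_layer w F (t : R) S :
  weight w S =
  weight (fun i => w i - t * (i \in F)%:R) S + t * #|S :&: F|%:R.
Proof. by rewrite -weight_indicator /weight sumrB mulr_sumr subrK. Qed.

(** The reduced weights vanish off [F], so only [I :&: F] counts. In a basis [J] of [S :&: F]
    containing it, the added elements have nonnegative reduced weight, and restoring [t] on [J]
    contributes [t] times the rank. *)
Lemma wrank_layer w F (t : R) S :
  (forall i, i \notin F -> w i = 0) -> (forall i, i \in F -> t <= w i) ->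
  wrank M (fun i => w i - t * (i \in F)%:R) S + t * (rank M (S :&: F))%:R
    <= wrank M w S.
Proof.
move=> wF0 wFt; rewrite -lerBrDr; apply: wrank_le => I iI IS; rewrite lerBrDr.
have iIF : indep M (I :&: F) by apply: indep_sub (subsetIl _ _) iI.
have [J [iJ IJ JSF <-]] := indep_extend iIF (setSI F IS).
apply: le_trans (le_wrank w iJ (subset_trans JSF (subsetIl _ _))).
rewrite (weight_layer w F t J) (setIidPl (subset_trans JSF (subsetIr _ _))).
rewrite lerD2r /weight (big_setID F) /= [X in _ + X]big1 ?addr0; last first.
  by move=> i /setDP[_ iF]; rewrite wF0 // (negPf iF) mulr0 subr0.
rewrite [leRHS](big_setID (I :&: F)) /= (setIidPr IJ) lerDl.
apply: sumr_ge0 => i /setDP[iJ' _].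
have iF : i \in F by have := subsetP JSF i iJ'; rewrite inE => /andP[].
by rewrite iF mulr1 subr_ge0 wFt.
Qed.

Lemma ler_Ex D (f g : {set E} -> R) : (forall S, f S <= g S) -> Ex D f <= Ex D g.
Proof. by move=> fg; apply: ler_sum => S _; rewrite ler_wpM2l ?pmf_ge0. Qed.

Lemma ExDZ D (f g : {set E} -> R) (t : R) :
  Ex D (fun S => f S + t * g S) = Ex D f + t * Ex D g.
Proof.
rewrite /Ex mulr_sumr -big_split; apply: eq_bigr => S _.
by rewrite mulrDr [D S * (t * _)]mulrCA.
Qed.

Lemma Ex_weight D w :
  Ex D (fun S => weight w S) = \sum_i w i * Pr D [set S : {set E} | i \in S].
Proof.
rewrite /Ex /weight /Pr.
under eq_bigr => S _ do rewrite mulr_sumr big_mkcond.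
rewrite exchange_big; apply: eq_bigr => i _ /=.
rewrite mulr_sumr [RHS]big_mkcond; apply: eq_bigr => S _.
by rewrite inE mulrC.
Qed.

Lemma Ex_bind D (phi : {set E} -> dist R {set E}) (f : {set E} -> R) :
  Ex (bind D phi) f = Ex D (fun S => Ex (phi S) f).
Proof.
rewrite /Ex /= /bind_pmf; under eq_bigr => I _ do rewrite mulr_suml.
rewrite exchange_big; apply: eq_bigr => S _ /=.
by rewrite mulr_sumr; apply: eq_bigr => I _; rewrite mulrA.
Qed.

Lemma Ex_crm_le_wrank (phi : {set E} -> dist R {set E}) w S :
  contention_resolution_map M phi -> Ex (phi S) (weight w) <= wrank M w S.
Proof.
move=> crm; rewrite -[leRHS]mul1r -(pmf_sum1 (phi S)) mulr_suml.
apply: ler_sum => I _; have [->|/crm[iI IS]] := eqVneq (phi S I) 0.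
  by rewrite !mul0r.
by rewrite ler_wpM2l ?pmf_ge0 ?le_wrank.
Qed.

Lemma competitive_wrank D (alpha : R) (phi : {set E} -> dist R {set E}) w :
  contention_resolution_map M phi -> competitive alpha D phi -> 0 <= alpha ->
  (forall i, 0 <= w i) ->
  Ex D (weight w) <= alpha * Ex D (wrank M w).
Proof.
move=> crm comp al0 w0; rewrite Ex_weight.
apply: (@le_trans _ _ (alpha * Ex (bind D phi) (weight w))).
  rewrite Ex_weight mulr_sumr; apply: ler_sum => i _.
  by rewrite mulrCA ler_wpM2l.
by rewrite ler_wpM2l // Ex_bind ler_Ex // => S; apply: Ex_crm_le_wrank.
Qed.

(** Induction on the size of the support [F] of [w]: lowering [w] on [F] by its least value there
    removes at least one point from the support, and the rank bound at [F] pays for the removed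
    layer. *)
Lemma rank_bound_wrank D (alpha : R) :
  0 <= alpha ->
  (forall F, Ex D (fun S => #|S :&: F|%:R) <=
             alpha * Ex D (fun S => (rank M (S :&: F))%:R)) ->
  forall w, (forall i, 0 <= w i) ->
  Ex D (weight w) <= alpha * Ex D (wrank M w).
Proof.
move=> al0 rankD w; have [n] := ubnP #|[set i | 0 < w i]|.
elim: n w => // n IHn w; rewrite ltnS; set F := [set i | 0 < w i] => Fn w0.
have wF0 i : i \notin F -> w i = 0.
  by rewrite inE -leNgt => wi; apply/le_anti; rewrite wi w0.
have [F0|[i0 i0F]] := set_0Vmem F.
  apply: (@le_trans _ _ 0); last first.
    by rewrite mulr_ge0 // sumr_ge0 // => S _; rewrite mulr_ge0 ?pmf_ge0 ?wrank_ge0.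
  rewrite Ex_weight big1 // => i _.
  by rewrite wF0 ?mul0r // F0 inE.
case: (Order.TotalTheory.arg_minP w i0F) => j jF jmin; have {}jF : j \in F := jF.
pose w' i := w i - w j * (i \in F)%:R.
have w'0 i : 0 <= w' i.
  rewrite /w'; have [iF|iF] := boolP (i \in F); last by rewrite mulr0 subr0.
  by rewrite mulr1 subr_ge0 jmin.
have ltF : (#|[set i | (0 < w' i)%R]| < n)%N.
  apply: leq_trans Fn; apply: proper_card; apply/properP; split.
    apply/subsetP => i; rewrite inE; apply: contraLR => iF.
    by rewrite /w' (negPf iF) mulr0 subr0 wF0 ?ltxx.
  by exists j; rewrite // inE /w' jF mulr1 subrr ltxx.
have Ew : Ex D (weight w) = Ex D (weight w') + w j * Ex D (fun S => #|S :&: F|%:R).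
  by rewrite -ExDZ; apply: eq_bigr => S _; rewrite (weight_layer w F (w j)).
apply: (@le_trans _ _ (alpha * (Ex D (wrank M w') +
    w j * Ex D (fun S => (rank M (S :&: F))%:R)))).
  by rewrite Ew mulrDr lerD ?IHn // mulrCA ler_wpM2l.
rewrite -ExDZ ler_wpM2l // ler_Ex // => S.
exact: wrank_layer.
Qed.

End WeightedRank.

(** * Competitive maps by duality *)

Section PointMass.
Variables (R : realType) (T : finType) (x : T).

Lemma point_mass_ge0 y : 0 <= (y == x)%:R :> R.
Proof. exact: ler0n. Qed.

Lemma point_mass_sum1 : \sum_y (y == x)%:R = 1 :> R.
Proof. by rewrite (bigD1 x) //= eqxx big1 ?addr0 // => y /negPf->. Qed.

Definition point_mass : dist R T := Dist point_mass_ge0 point_mass_sum1.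
End PointMass.

(** [k x] is the conditional law [q x y / D x]. Where [D x = 0] the whole row [q x] is zero, so any
    law fits; a point mass at [u0 x] keeps the support under control. *)
Lemma joint_law_kernel (R : realType) (T U : finType) (D : dist R T)
    (q : T -> U -> R) (u0 : T -> U) :
  (forall x y, 0 <= q x y) -> (forall x, \sum_y q x y = D x) ->
  exists k : T -> dist R U, (forall x y, D x * k x y = q x y) /\
    (forall x y, k x y != 0 -> q x y != 0 \/ y = u0 x).
Proof.
move=> q0 qD.
have kP x : exists k : dist R U, (forall y, D x * k y = q x y) /\
    (forall y, k y != 0 -> q x y != 0 \/ y = u0 x).
  have [Dx0|Dx0] := eqVneq (D x) 0.
    exists (point_mass R (u0 x)); split=> y /=.
      rewrite Dx0 mul0r; move/eqP: (qD x); rewrite Dx0 psumr_eq0 // => /allP.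
      by move=> /(_ y (mem_index_enum y))/eqP->.
    by have [->|_] := eqVneq y (u0 x); [right|rewrite eqxx].
  have k0 y : 0 <= q x y / D x by rewrite divr_ge0 ?pmf_ge0.
  have k1 : \sum_y q x y / D x = 1 by rewrite -mulr_suml qD divff.
  exists (Dist k0 k1); split=> y /=; first by rewrite mulrC divfK.
  by rewrite mulf_eq0 negb_or => /andP[]; left.
have [k kq] := boolp.choice kP.
by exists k; split=> x; case: (kq x).
Qed.

(* The unknowns of the linear system are the joint probabilities [q S I] that
   [R = S] and [phi R = I]; a Farkas certificate is a pair of a weight vector
   on [E] and a price on [{set E}] dominating the weighted rank. *)
Lemma wrank_bound_uncontentious (R : realType) (E : finType) (M : matroid E)
    (D : dist R {set E}) (alpha : R) :
  0 < alpha ->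
  (forall w : E -> R, (forall i, 0 <= w i) ->
     1 / alpha * Ex D (weight w) <= Ex D (wrank M w)) ->
  uncontentious M alpha D.
Proof.
move=> al0 wrankD.
pose ok (S I : {set E}) := indep M I && (I \subset S).
(* Coordinates: [inl i] is competitiveness at [i], [inr C] the negated marginal equation at [C].
   Generators: [inl (A, B)] carries the unknown [q A B] and is zero for inadmissible pairs; [inr i]
   is the slack at [i]. *)
pose a (j : {set E} * {set E} + E) (t : E + {set E}) : R :=
  match j, t with
  | inl (A, B), inl i => (ok A B && (i \in B))%:R
  | inl (A, B), inr C => - (ok A B && (A == C))%:R
  | inr i, inl i' => - (i == i')%:R
  | inr _, inr _ => 0
  end.
pose c (t : E + {set E}) : R :=
  match t with
  | inl i => 1 / alpha * Pr D [set S : {set E} | i \in S]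
  | inr A => - D A
  end.
(* Slack generators force [w] nonnegative; pair generators force [x (inr S)] to dominate the
   weighted rank of [S]. *)
have ac x : (forall j, dot (a j) x <= 0) -> dot c x <= 0.
  move=> ax; pose w i := x (inl i).
  have w0 i : 0 <= w i.
    have := ax (inr i); rewrite /dot big_sumType /= [X in _ + X]big1 ?addr0; last first.
      by move=> S _; rewrite mul0r.
    rewrite (bigD1 i) //= big1 ?addr0 ?eqxx ?mulN1r ?oppr_le0 //.
    by move=> j /negPf; rewrite eq_sym => ->; rewrite oppr0 mul0r.
  have wz S : wrank M w S <= x (inr S).
    apply: wrank_le => I iI IS; have := ax (inl (S, I)).
    rewrite /dot big_sumType /= /ok iI IS /= (bigD1 S) //= eqxx.
    rewrite [X in _ + (_ + X)]big1 ?addr0; last first.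
      by move=> S' /negPf; rewrite eq_sym => ->; rewrite oppr0 mul0r.
    rewrite mulN1r subr_le0; apply: le_trans; rewrite /weight big_mkcond /=.
    by apply: ler_sum => i _; case: (i \in I); rewrite ?mul1r ?mul0r.
  rewrite /dot big_sumType /=; under [X in _ + X]eq_bigr => S _ do rewrite mulNr.
  rewrite sumrN subr_le0; apply: (@le_trans _ _ (Ex D (wrank M w))); last first.
    exact: ler_Ex.
  apply: le_trans (wrankD w w0); rewrite Ex_weight mulr_sumr.
  by apply: ler_sum => i _; rewrite [w i * _]mulrC !mulrA.
have [l l0 cl] := farkas ac.
(* Generators of inadmissible pairs vanish, so their multipliers can be reset to zero. *)
pose q S I := if ok S I then l (inl (S, I)) else 0.
have q0 S I : 0 <= q S I by rewrite /q; case: ifP.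
have pairE (F : {set E} * {set E} -> R) : \sum_p F p = \sum_A \sum_B F (A, B).
  by rewrite pair_bigA; apply: eq_bigr => -[].
have qD S : \sum_I q S I = D S.
  apply/oppr_inj; rewrite -[RHS]/(c (inr S)) cl big_sumType /=.
  rewrite [X in _ + X]big1 ?addr0; last by move=> i _; rewrite mulr0.
  rewrite pairE /=.
  rewrite [RHS](bigD1 S) //= [X in _ + X]big1 ?addr0; last first.
    by move=> S' /negPf S'S; rewrite big1 // => I _; rewrite S'S andbF oppr0 mulr0.
  rewrite -sumrN; apply: eq_bigr => I _.
  by rewrite /q eqxx andbT; case: (ok S I); rewrite ?mulrN1 ?oppr0 ?mulr0.
(* The empty set is admissible for every [S], hence a safe default where [D S = 0]. *)
have [phi [phiq phi_supp]] := joint_law_kernel (fun=> set0) q0 qD.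
exists phi; split=> [S I|i].
  case/phi_supp=> [|->]; last by rewrite indep0 sub0set.
  by rewrite /q; case: ifP => [/andP[]|]; rewrite ?eqxx.
(* In coordinate [inl i] of [cl] the slack terms are nonpositive; dropping them leaves the
   inequality. *)
rewrite -ler_pdivrMl // -div1r -[leLHS]/(c (inl i)) cl big_sumType /=.
rewrite -[leRHS]addr0 lerD //; last first.
  by apply: sumr_le0 => j _; rewrite mulrN oppr_le0 mulr_ge0 ?l0 ?ler0n.
rewrite pairE exchange_big /Pr /= [leRHS]big_mkcond /=; apply: ler_sum => I _.
rewrite inE; case: (i \in I); last by rewrite big1 // => S _; rewrite andbF mulr0.
apply: ler_sum => S _; rewrite phiq /q andbT.
by case: (ok S I); rewrite ?mulr1 ?mulr0.
Qed.

Theorem theorem3 (R : realType) (E : finType) (M : matroid E)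
    (D : dist R {set E}) (alpha : R) (halpha : 1 <= alpha) :
  [<-> uncontentious M alpha D;
       forall w : E -> R, (forall i, 0 <= w i) ->
         Ex D (fun S => wrank M w S) >= 1 / alpha * Ex D (fun S => weight w S);
       forall F : {set E},
         Ex D (fun S => #|S :&: F|%:R)
           <= alpha * Ex D (fun S => (rank M (S :&: F))%:R)].
Proof.
have al0 : 0 < alpha by apply: lt_le_trans halpha.
tfae=> [[phi [crm comp]] w w0|wrankD F|rankD].
- by rewrite div1r ler_pdivrMl // (competitive_wrank crm comp (ltW al0)).
- rewrite -ler_pdivrMl // -div1r.
  apply: le_trans (ler_Ex D (wrank_indicator_le R M F)).
  apply: le_trans (wrankD (fun i => (i \in F)%:R) (fun i => ler0n R _)).
  rewrite ler_wpM2l ?divr_ge0 ?ler01 ?(ltW al0) // ler_Ex // => S.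
  by rewrite weight_indicator.
- apply: wrank_bound_uncontentious => // w w0.
  by rewrite div1r ler_pdivrMl //; apply: rank_bound_wrank => //; apply: ltW.
Qed.
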